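(* There exists an absolute constant $c$ such that the following holds. Let $\mathfrak{L}$ be a collection of $L$ lines in $\mathbb{R}^3$ (with $L$ finite), and let $J$ be the set of joints formed by $\mathfrak{L}$. Then $$\sum_{x \in J} N(x)^{1/2} \leq c \cdot L^{3/2}.$$
   Context: A collection of lines is a set of distinct lines. A point $x\in\mathbb{R}^3$ is a joint for (formed by) a collection $\mathfrak{L}$ of lines in $\mathbb{R}^3$ if there exist at least three lines in $\mathfrak{L}$ passing through $x$ whose directions span $\mathbb{R}^3$. The multiplicity $N(x)$ of a joint $x$ is the number of (unordered) triples of lines of $\mathfrak{L}$ through $x$ whose directions span $\mathbb{R}^3$. *)

(* Defs.v *)
From HB Require Import structures.
From mathcomp Require Import all_boot all_order all_algebra finmap.
From mathcomp Require Import all_classical all_reals all_analysis.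

Set Implicit Arguments.
Unset Strict Implicit.
Unset Printing Implicit Defensive.

Import Order.TTheory GRing.Theory Num.Theory.
Local Open Scope classical_set_scope.
Local Open Scope ring_scope.

Definition is_direction (R : realType) (l : set 'rV[R]_3) (d : 'rV[R]_3) : Prop :=
  d != 0 /\ exists p : 'rV[R]_3, l = [set p + t *: d | t in [set: R]].

Definition is_line (R : realType) (l : set 'rV[R]_3) : Prop :=
  exists d, is_direction l d.

(* Directions are unique up to nonzero scalars, so the choice of d1, d2, d3 is
   immaterial. Three lines satisfying this are automatically distinct. *)
Definition directions_span (R : realType) (l1 l2 l3 : set 'rV[R]_3) : Prop :=
  exists d1 d2 d3 : 'rV[R]_3,
    [/\ is_direction l1 d1, is_direction l2 d2, is_direction l3 d3
      & <<[:: d1; d2; d3]>>%VS = fullv].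

Definition spanning_triple_at (R : realType) (x : 'rV[R]_3)
    (T : {fset (set 'rV[R]_3)}) : Prop :=
  exists l1 l2 l3 : set 'rV[R]_3,
    [/\ T = [fset l1; l2; l3]%fset, l1 x, l2 x, l3 x & directions_span l1 l2 l3].

Definition joints (R : realType) (LL : {fset (set 'rV[R]_3)}) : set 'rV[R]_3 :=
  [set x | exists l1 l2 l3 : set 'rV[R]_3,
    [/\ [/\ l1 \in LL, l2 \in LL & l3 \in LL],
        l1 x, l2 x, l3 x & directions_span l1 l2 l3]].

Definition multiplicity (R : realType) (LL : {fset (set 'rV[R]_3)})
    (x : 'rV[R]_3) : nat :=
  #|` [fset T in fpowerset LL | `[< spanning_triple_at x T >]]%fset|.

Lemma line_direction_through (R : realType) (l : set 'rV[R]_3) d x y :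
  is_direction l d -> l x -> l y -> exists t, y - x = t *: d.
Proof.
move=> [_ [p ->]] [t _ <-] [s _ <-]; exists (s - t).
by rewrite scalerBl opprD addrACA subrr add0r.
Qed.

(* A sum \sum_(x \in joints LL) over this classical set is thus a genuine finite
   sum, never the 0 assigned by convention to infinite supports. *)
Lemma finite_joints (R : realType) (LL : {fset (set 'rV[R]_3)}) :
  finite_set (joints LL).
Proof.
pose P (l1 l2 : set 'rV[R]_3) : set 'rV[R]_3 :=
  [set x | [/\ l1 x, l2 x & exists l3, directions_span l1 l2 l3]].
have fP l1 l2 : finite_set (P l1 l2).
  have [->|/set0P[x Px]] := eqVneq (P l1 l2) set0; first exact: finite_set0.
  apply: (@sub_finite_set _ _ [set x]); last exact: finite_set1.
  move=> y [l1y l2y _]; case: Px => l1x l2x [l3 [d1 [d2 [d3 [D1 D2 D3 sp]]]]].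
  have [t yx1] := line_direction_through D1 l1x l1y.
  have [s yx2] := line_direction_through D2 l2x l2y.
  have fr : free [:: d1; d2; d3].
    by rewrite /free sp dimvf /dim /= mul1n.
  move: fr; rewrite free_cons => /andP[d1n _].
  have [t0|t0] := eqVneq t 0.
    by apply/eqP; rewrite -subr_eq0 yx1 t0 scale0r.
  case/negP: d1n.
  have -> : d1 = (t^-1 * s) *: d2.
    by rewrite -scalerA -yx2 yx1 scalerA mulVf // scale1r.
  by rewrite memvZ// memv_span// mem_head.
apply: (@sub_finite_set _ _ (\bigcup_(l1 in [set` LL]) \bigcup_(l2 in [set` LL]) P l1 l2)).
  move=> x [l1 [l2 [l3 [[h1 h2 h3] x1 x2 x3 sp]]]].
  by exists l1 => //; exists l2 => //; split=> //; exists l3.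
by do 2 (apply: bigcup_finite => [|? _]; first exact: finite_fset).
Qed.

(* Main.v *)
Require Import Defs.
From HB Require Import structures.
From mathcomp Require Import all_boot all_order all_algebra finmap.
From mathcomp Require Import all_classical all_reals all_analysis.
From mathcomp Require Import ring lra zify.

(* Give every joint [p] a number [alpha p] and let [level l], for a line [l], be the
   largest [t] with [sum_(q on l) (alpha q - t)^+ >= 3n]; put
   [excess p l := (alpha p - level l)^+]. A nonzero polynomial of degree [< n] in each
   variable cannot, at every joint [p] and for one spanning triple through [p], have all
   its coefficients [x^i y^j z^k] with [i], [j], [k] below the three excesses equal to 0,
   [x], [y], [z] being the coordinates along the triple: at a joint minimizing (order of
   vanishing) - [alpha], some derivative restricted to a line would have at least [3n]
   zeros. Counting dimensions, the products of the three excesses sum to at least [n^3].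

   Raising one [alpha p] raises the smallest such product [W p] at [p] and lowers the
   others, so [alpha] can be balanced to make [W p] at least of order
   [n^3 N(p)^(1/2) / D], where [D] is the sum of the [N(p)^(1/2)]. Since
   [N(p) W p <= (sum_(l through p) excess p l)^3] and each line carries total excess about
   [3n], summing over [p] yields [D^(2/3) = O(L)]. *)

Set Implicit Arguments.
Unset Strict Implicit.
Unset Printing Implicit Defensive.

Import Order.TTheory GRing.Theory Num.Theory.
Local Open Scope ring_scope.

(** * Trivariate polynomials *)

(** A matrix with more rows than columns has a nonzero left kernel vector. This is the dimension
    count behind [vanishing_conditions]. *)
Lemma kernel_family (F : fieldType) (T C : finType) (A : T -> C -> F) :
  (#|C| < #|T|)%N ->
  exists2 g : T -> F, (exists t, g t != 0) & forall c, \sum_t g t * A t c = 0.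
Proof.
move=> ltCT; pose M := \matrix_(i < #|T|, j < #|C|) A (enum_val i) (enum_val j).
have : kermx M != 0.
  rewrite kermx_eq0 /row_free; apply/negP => /eqP rM.
  by have := rank_leq_col M; rewrite rM leqNgt ltCT.
case/rowV0Pn => v /sub_kermxP vM /rV0Pn[i vi].
exists (fun t => v 0 (enum_rank t)) => [|c].
  by exists (enum_val i); rewrite enum_valK.
have := congr1 (fun w : 'rV_ _ => w 0 (enum_rank c)) vM; rewrite !mxE; apply: etrans.
rewrite (reindex (@enum_val T predT)) /=; last first.
  exact: onW_bij (enum_val_bij T).
by apply: eq_bigr => j _; rewrite mxE enum_valK enum_rankK.
Qed.

Lemma poly_horner_eq0 (R : realFieldType) (p : {poly R}) :
  (forall x, p.[x] = 0) -> p = 0.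
Proof.
move=> p0; apply/eqP/negPn/negP => pn0.
pose s : seq R := [seq i%:R | i <- iota 0 (size p)].
have := @max_poly_roots _ p s pn0; rewrite size_map size_iota ltnn.
move=> /(_ _ _)/negP; apply => //; first by apply/allP => x _; apply/rootP.
by rewrite map_inj_uniq ?iota_uniq// => i j /eqP; rewrite eqr_nat => /eqP.
Qed.

Lemma poly_horner_inj (R : realFieldType) (p q : {poly R}) :
  (forall x, p.[x] = q.[x]) -> p = q.
Proof.
by move=> pq; apply/subr0_eq/poly_horner_eq0 => x; rewrite hornerD hornerN pq subrr.
Qed.

Lemma sum_pow_eq0 (R : realFieldType) (K : nat) (c : nat -> R) :
  (forall x, \sum_(i < K) c i * x ^+ i = 0) -> forall i, (i < K)%N -> c i = 0.
Proof.
move=> c0 i iK; have /polyP/(_ i) : \poly_(j < K) c j = 0.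
  by apply: poly_horner_eq0 => x; rewrite horner_poly.
by rewrite coef_poly iK coef0.
Qed.

(** One cut-off serves all three indices, so that polynomials of different sizes can be compared
    after enlarging [K]. *)
Definition sum3 (V : nmodType) (K : nat) (c : nat -> nat -> nat -> V) : V :=
  \sum_(i < K) \sum_(j < K) \sum_(k < K) c i j k.

Lemma eq_sum3 (V : nmodType) (K : nat) (c c' : nat -> nat -> nat -> V) :
  (forall i j k, (i < K)%N -> (j < K)%N -> (k < K)%N -> c i j k = c' i j k) ->
  sum3 K c = sum3 K c'.
Proof.
move=> cc'; rewrite /sum3; apply: eq_bigr => i _; apply: eq_bigr => j _.
by apply: eq_bigr => k _; apply: cc'.
Qed.

Lemma rmorph_sum3 (U V : nzRingType) (f : {rmorphism U -> V}) (K : nat)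
    (c : nat -> nat -> nat -> U) :
  f (sum3 K c) = sum3 K (fun i j k => f (c i j k)).
Proof.
rewrite /sum3 rmorph_sum; apply: eq_bigr => i _; rewrite rmorph_sum.
by apply: eq_bigr => j _; rewrite rmorph_sum.
Qed.

Lemma sum3_eq0 (V : nmodType) (K : nat) (c : nat -> nat -> nat -> V) :
  (forall i j k, (i < K)%N -> (j < K)%N -> (k < K)%N -> c i j k = 0) ->
  sum3 K c = 0.
Proof.
move=> c0; apply: big1 => i _; apply: big1 => j _; apply: big1 => k _.
exact: c0.
Qed.

Lemma sum3B (V : zmodType) (K : nat) (c c' : nat -> nat -> nat -> V) :
  sum3 K c - sum3 K c' = sum3 K (fun i j k => c i j k - c' i j k).
Proof.
rewrite /sum3 -sumrB; apply: eq_bigr => i _; rewrite -sumrB.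
by apply: eq_bigr => j _; rewrite -sumrB.
Qed.

Lemma sum3_swap12 (V : nmodType) (K : nat) (c : nat -> nat -> nat -> V) :
  sum3 K c = sum3 K (fun i j k => c j i k).
Proof. exact: exchange_big. Qed.

Lemma sum3_swap23 (V : nmodType) (K : nat) (c : nat -> nat -> nat -> V) :
  sum3 K c = sum3 K (fun i j k => c i k j).
Proof. by apply: eq_bigr => i _; exact: exchange_big. Qed.

Lemma sum3_pow_eq0 (R : realFieldType) (K : nat) (c : nat -> nat -> nat -> R) :
  (forall x y z, sum3 K (fun i j k => c i j k * x ^+ i * y ^+ j * z ^+ k) = 0) ->
  forall i j k, (i < K)%N -> (j < K)%N -> (k < K)%N -> c i j k = 0.
Proof.
move=> c0 i j k iK jK; move: k; apply: sum_pow_eq0 => z; move: j jK.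
apply: sum_pow_eq0 => y; move: i iK.
apply: (@sum_pow_eq0 _ _ (fun i => \sum_(j < K) (\sum_(k < K) c i j k * z ^+ k) * y ^+ j)) => x.
rewrite -[RHS](c0 x y z) /sum3; apply: eq_bigr => i _.
rewrite mulr_suml; apply: eq_bigr => j _; rewrite !mulr_suml.
by apply: eq_bigr => k _; ring.
Qed.

Definition eval3 (R : comNzRingType) (P : {poly {poly {poly R}}}) (x y z : R) : R :=
  P.[x%:P%:P].[y%:P].[z].

Lemma eval3_coef (R : comNzRingType) (P : {poly {poly {poly R}}}) :
  exists K0 : nat, forall K, (K0 <= K)%N -> forall x y z,
    eval3 P x y z = sum3 K (fun i j k => P`_i`_j`_k * x ^+ i * y ^+ j * z ^+ k).
Proof.
(* This number bounds at once the sizes of [P], of its coefficients and of their coefficients. *)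
exists (size P + \sum_(i < size P) (size (P`_i)%R + \sum_(j < size (P`_i)%R) size (P`_i`_j)%R))%N.
move=> K hK x y z.
have s1 : (size P <= K)%N by apply: leq_trans hK; exact: leq_addr.
have s2' i : (size (P`_i)%R + \sum_(j < size (P`_i)%R) size (P`_i`_j)%R <= K)%N.
  have [/(nth_default 0)->|iP] := leqP (size P) i.
    by rewrite size_poly0 big_ord0.
  apply: leq_trans hK; apply: leq_trans (leq_addl _ _).
  by rewrite (bigD1 (Ordinal iP)) //= leq_addr.
have s2 i : (size (P`_i)%R <= K)%N by apply: leq_trans (s2' i); exact: leq_addr.
have s3 i j : (size (P`_i`_j)%R <= K)%N.
  have [/(nth_default 0)->|jP] := leqP (size (P`_i)%R) j; first by rewrite size_poly0.
  apply: leq_trans (s2' i); apply: leq_trans (leq_addl _ _).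
  by rewrite (bigD1 (Ordinal jP)) //= leq_addr.
rewrite /eval3 (horner_coef_wide _ s1) !horner_sum; apply: eq_bigr => i _.
rewrite hornerM (horner_coef_wide _ (s2 i)) hornerM horner_sum.
rewrite !horner_exp !hornerC mulr_suml; apply: eq_bigr => j _.
rewrite hornerM (horner_coef_wide _ (s3 i j)) horner_exp !hornerC !mulr_suml.
by apply: eq_bigr => k _; ring.
Qed.

(** Values determine coefficients over an infinite field. Together with [eval3_swap13] this moves
    any direction of a frame to the first place, where the line argument is carried out. *)
Lemma eval3_swap12 (R : realFieldType) (P Q : {poly {poly {poly R}}}) :
  (forall x y z, eval3 P x y z = eval3 Q y x z) ->
  forall i j k, P`_i`_j`_k = Q`_j`_i`_k.
Proof.
move=> PQ i j k; have [KP hP] := eval3_coef P; have [KQ hQ] := eval3_coef Q.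
pose K := (KP + KQ + (i + j + k).+1)%N; apply/subr0_eq.
apply: (@sum3_pow_eq0 _ K (fun i j k => P`_i`_j`_k - Q`_j`_i`_k)); try by rewrite /K; lia.
move=> x y z; have := PQ x y z; rewrite (hP K) ?(hQ K); try by rewrite /K; lia.
rewrite [RHS]sum3_swap12 => /eqP; rewrite -subr_eq0 sum3B => /eqP; apply: etrans.
by apply: eq_sum3 => *; ring.
Qed.

Lemma eval3_swap13 (R : realFieldType) (P Q : {poly {poly {poly R}}}) :
  (forall x y z, eval3 P x y z = eval3 Q z y x) ->
  forall i j k, P`_i`_j`_k = Q`_k`_j`_i.
Proof.
move=> PQ i j k; have [KP hP] := eval3_coef P; have [KQ hQ] := eval3_coef Q.
pose K := (KP + KQ + (i + j + k).+1)%N; apply/subr0_eq.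
apply: (@sum3_pow_eq0 _ K (fun i j k => P`_i`_j`_k - Q`_k`_j`_i)); try by rewrite /K; lia.
move=> x y z; have := PQ x y z; rewrite (hP K) ?(hQ K); try by rewrite /K; lia.
rewrite [RHS]sum3_swap12 [RHS]sum3_swap23 [RHS]sum3_swap12 => /eqP.
rewrite -subr_eq0 sum3B => /eqP; apply: etrans.
by apply: eq_sum3 => *; ring.
Qed.

Definition monomial3 (A : comNzRingType) (v : 'I_3 -> A) (i j k : nat) : A :=
  v 0 ^+ i * v 1 ^+ j * v 2%:R ^+ k.

Lemma rmorph_monomial3 (A B : comNzRingType) (f : {rmorphism A -> B}) v w i j k :
  (forall a, f (v a) = w a) -> f (monomial3 v i j k) = monomial3 w i j k.
Proof. by move=> vw; rewrite /monomial3 !rmorphM !rmorphXn /= !vw. Qed.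

Lemma size_mul_leqS (B : nzRingType) (p q : {poly B}) a b :
  (size p <= a.+1)%N -> (size q <= b.+1)%N -> (size (p * q)%R <= (a + b).+1)%N.
Proof.
move=> pa qb; rewrite (leq_trans (size_polyMleq _ _))//.
by move: pa qb; lia.
Qed.

Lemma size_monomial3 (B : comNzRingType) (L : 'I_3 -> {poly B}) i j k :
  (forall a, size (L a) <= 2)%N -> (size (monomial3 L i j k) <= (i + j + k).+1)%N.
Proof.
move=> L2; have sp a e : (size (L a ^+ e) <= e.+1)%N.
  rewrite (leq_trans (size_poly_exp_leq _ _))// ltnS.
  by rewrite -[leqRHS]mul1n leq_mul2r orbC -subn1 leq_subLR L2.
by rewrite /monomial3 !size_mul_leqS.
Qed.

(** * Expansions in a frame and orders of vanishing *)

Section Expansion.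
Variables (R : realFieldType) (n : nat) (g : nat -> nat -> nat -> R).
Implicit Types p u d : 'rV[R]_3.

(* [g i j k] is the coefficient of [u_0^i u_1^j u_2^k]; only exponents [< n] are used. *)
Definition peval u : R := sum3 n (fun i j k => g i j k * monomial3 (u 0) i j k).

(** The coefficient of degree [m], as a function of [u], is the homogeneous part of degree [m] of
    the Taylor expansion at [p]. *)
Definition line_poly p u : {poly R} :=
  sum3 n (fun i j k => (g i j k)%:P *
    monomial3 (fun a => 'X * (u 0 a)%:P + (p 0 a)%:P) i j k).

Definition affine3 p d1 d2 d3 (a : 'I_3) : {poly {poly {poly R}}} :=
  'X * (d1 0 a)%:P%:P%:P +
  ('X * (d2 0 a)%:P%:P + ('X * (d3 0 a)%:P + (p 0 a)%:P)%:P)%:P.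

Definition expansion p d1 d2 d3 : {poly {poly {poly R}}} :=
  sum3 n (fun i j k => (g i j k)%:P%:P%:P * monomial3 (affine3 p d1 d2 d3) i j k).

Lemma horner_line_poly p u t : (line_poly p u).[t] = peval (p + t *: u).
Proof.
rewrite -horner_evalE rmorph_sum3; apply: eq_sum3 => i j k _ _ _.
rewrite rmorphM (rmorph_monomial3 _ (w := (p + t *: u) 0)) => [|a].
  by rewrite /= horner_evalE hornerC.
by rewrite /= horner_evalE !hornerE !mxE addrC.
Qed.

Lemma eval3_expansion p d1 d2 d3 x y z :
  eval3 (expansion p d1 d2 d3) x y z = peval (p + (x *: d1 + y *: d2 + z *: d3)).
Proof.
pose ev : {rmorphism {poly {poly {poly R}}} -> R} :=
  (horner_eval z \o (horner_eval y%:P \o horner_eval x%:P%:P))%FUN.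
rewrite -[LHS]/(ev (expansion p d1 d2 d3)) rmorph_sum3.
apply: eq_sum3 => i j k _ _ _; rewrite rmorphM.
rewrite (rmorph_monomial3 _ (w := (p + (x *: d1 + y *: d2 + z *: d3)) 0)) => [|a].
  by rewrite /ev /= !horner_evalE !hornerC.
by rewrite /ev /= !horner_evalE !hornerE !mxE /=; ring.
Qed.

Lemma peval_eq0 : (forall u, peval u = 0) ->
  forall i j k, (i < n)%N -> (j < n)%N -> (k < n)%N -> g i j k = 0.
Proof.
move=> g0; apply: sum3_pow_eq0 => x y z.
rewrite -(g0 (\row_a [:: x; y; z]`_a)); apply: eq_sum3 => i j k _ _ _.
by rewrite /monomial3 !mxE !mulrA.
Qed.

(** All exponents are below [n], so total degrees are below [3 * n], and affine substitution does
    not raise them. This is the source of the threshold [3 * n] on zeros along a line. *)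
Lemma size_expansion p d1 d2 d3 : (size (expansion p d1 d2 d3) <= 3 * n)%N.
Proof.
have sizeD (q r : {poly {poly {poly R}}}) m : (size q <= m)%N -> (size r <= m)%N ->
    (size (q + r)%R <= m)%N.
  by move=> qm rm; rewrite (leq_trans (size_polyD _ _))// geq_max qm.
have saff a : (size (affine3 p d1 d2 d3 a) <= 2)%N.
  apply: sizeD; last by rewrite (leq_trans (size_polyC_leq1 _)).
  by rewrite (leq_trans (size_polyMleq _ _))// size_polyX size_polyC; case: eqP.
have sizeS (I : finType) (F : I -> {poly {poly {poly R}}}) m :
    (forall i, size (F i) <= m)%N -> (size (\sum_i F i)%R <= m)%N.
  by move=> Fm; elim/big_ind: _ => [|q r|//]; [rewrite size_poly0|exact: sizeD].
apply: (sizeS) => i; apply: (sizeS) => j; apply: (sizeS) => k.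
have ijk : (0 + (i + j + k) < 3 * n)%N.
  by have := ltn_ord i; have := ltn_ord j; have := ltn_ord k; lia.
apply: leq_trans ijk; apply: size_mul_leqS; first exact: size_polyC_leq1.
exact: size_monomial3.
Qed.

(** Scaling the three coordinates by [t] multiplies a monomial by [t ^+ (i + j + k)], so degree [m]
    along the line collects the monomials of total degree [m]. *)
Lemma line_poly_coef p d1 d2 d3 : exists K0 : nat, forall K, (K0 <= K)%N ->
  forall x y z m, (line_poly p (x *: d1 + y *: d2 + z *: d3))`_m =
    sum3 K (fun i j k => (if (i + j + k == m)%N then (expansion p d1 d2 d3)`_i`_j`_k
                          else 0) * x ^+ i * y ^+ j * z ^+ k).
Proof.
have [K0 hK0] := eval3_coef (expansion p d1 d2 d3); exists K0 => K hK x y z m.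
have -> : line_poly p (x *: d1 + y *: d2 + z *: d3) =
    sum3 K (fun i j k => ((expansion p d1 d2 d3)`_i`_j`_k * x ^+ i * y ^+ j * z ^+ k)
                           *: 'X^(i + j + k)).
  apply: poly_horner_inj => t; rewrite horner_line_poly !scalerDr !scalerA.
  rewrite -eval3_expansion (hK0 K hK) -[RHS]horner_evalE rmorph_sum3.
  apply: eq_sum3 => i j k _ _ _; rewrite /= horner_evalE !hornerE !exprMn !exprD.
  by ring.
rewrite /sum3 coef_sum; apply: eq_bigr => i _; rewrite coef_sum.
apply: eq_bigr => j _; rewrite coef_sum; apply: eq_bigr => k _.
rewrite coefZ coefXn eq_sym; case: eqP => _; rewrite ?mulr1//.
by rewrite !mul0r mulr0.
Qed.

(* All partial derivatives of order [< m] vanish at [p], expressed without a basis. *)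
Definition vanishes p m := forall u e, (e < m)%N -> (line_poly p u)`_e = 0.

Lemma vanishes_coef p m d1 d2 d3 i j k : vanishes p m -> (i + j + k < m)%N ->
  (expansion p d1 d2 d3)`_i`_j`_k = 0.
Proof.
move=> pm ijk; have [K0 hK0] := line_poly_coef p d1 d2 d3.
pose c i' j' k' := if (i' + j' + k' == i + j + k)%N then
  (expansion p d1 d2 d3)`_i'`_j'`_k' else 0.
have /(_ i j k) : forall i' j' k', (i' < K0 + (i + j + k).+1)%N ->
    (j' < K0 + (i + j + k).+1)%N -> (k' < K0 + (i + j + k).+1)%N -> c i' j' k' = 0.
  apply: sum3_pow_eq0 => x y z.
  by rewrite -(hK0 _ _ x y z (i + j + k)%N) ?pm//; lia.
by rewrite /c eqxx; apply; lia.
Qed.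

Definition spans d1 d2 d3 := forall u, exists x y z, u = x *: d1 + y *: d2 + z *: d3.

(** Take for [m] the least degree with a nonzero coefficient on some line through [p]; it exists
    because the polynomial is nonzero. The direction of that line has coordinates in every spanning
    triple, so the same [m] serves all frames. *)
Lemma exact_order p i0 j0 k0 : (i0 < n)%N -> (j0 < n)%N -> (k0 < n)%N ->
  g i0 j0 k0 != 0 -> exists2 m, vanishes p m & forall d1 d2 d3, spans d1 d2 d3 ->
  exists i j k, (i + j + k)%N = m /\ (expansion p d1 d2 d3)`_i`_j`_k != 0.
Proof.
move=> i0n j0n k0n g0.
have ex : exists m, `[< exists u, (line_poly p u)`_m != 0 >].
  apply: contrapT => no; case/eqP: g0; apply: peval_eq0 => // u.
  have -> : u = p + 1 *: (u - p) by rewrite scale1r addrC subrK.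
  rewrite -horner_line_poly; have -> : line_poly p (u - p) = 0; last by rewrite horner0.
  apply/polyP => m; rewrite coef0; apply: contrapT => /eqP um.
  by apply: no; exists m; apply/asboolP; exists (u - p).
case: (ex_minnP ex) => m /asboolP[u um] mmin; exists m.
  move=> w e em; apply/eqP/negPn/negP => we.
  have /mmin : `[< exists u, (line_poly p u)`_e != 0 >] by apply/asboolP; exists w.
  by rewrite leqNgt em.
move=> d1 d2 d3 /(_ u)[x [y [z uE]]]; apply: contrapT => no; case/eqP: um.
have [K0 hK0] := line_poly_coef p d1 d2 d3.
rewrite uE (hK0 _ (leqnn _)); apply: sum3_eq0 => i j k _ _ _.
case: eqP => [ijk|]; last by rewrite !mul0r.
have [->|ne] := eqVneq ((expansion p d1 d2 d3)`_i`_j`_k) 0; first by rewrite !mul0r.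
by case: no; exists i, j, k.
Qed.

(** Up to factorials, the restriction to a line of a mixed derivative in the two other
    directions. *)
Definition slice j k (P : {poly {poly {poly R}}}) : {poly R} :=
  map_poly (fun q : {poly {poly R}} => q`_j`_k) P.

Lemma coef_slice j k P i : (slice j k P)`_i = P`_i`_j`_k.
Proof. by rewrite coef_map_id0 ?coef0. Qed.

Lemma size_slice j k P : (size (slice j k P) <= size P)%N.
Proof. exact: size_poly. Qed.

Lemma horner_slice j k P x : (slice j k P).[x] = P.[x%:P%:P]`_j`_k.
Proof.
rewrite (horner_coef_wide _ (size_slice j k P)) horner_coef !coef_sum.
apply: eq_bigr => i _; rewrite coef_slice.
by rewrite -!polyC_exp !coefMC.
Qed.

(** Moving the centre along [d1] only shifts the first coordinate and leaves the other two
    untouched. *)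
Lemma slice_translate j k p d1 d2 d3 s :
  slice j k (expansion (p + s *: d1) d1 d2 d3) =
  slice j k (expansion p d1 d2 d3) \Po ('X + s%:P).
Proof.
apply: poly_horner_inj => x; apply: etrans (horner_slice _ _ _ _) _.
rewrite horner_comp; apply: etrans (esym (horner_slice _ _ _ _)).
rewrite hornerD hornerX hornerC.
apply: (congr1 (fun q : {poly {poly R}} => q`_j`_k)); rewrite -!horner_evalE !rmorph_sum3.
apply: eq_sum3 => a b c _ _ _; rewrite [LHS]rmorphM [RHS]rmorphM.
pose v a := horner_eval x%:P%:P (affine3 (p + s *: d1) d1 d2 d3 a).
rewrite (rmorph_monomial3 _ (w := v))// (rmorph_monomial3 _ (w := v)).
  by rewrite /= !horner_evalE !hornerC.
move=> e; rewrite /v /= !horner_evalE !hornerE !mxE !(polyCD, polyCM) /=.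
by ring.
Qed.

(** The powers [('X - (a q)%:P) ^+ m q] divide [h] and are pairwise coprime, so their product
    divides [h]. *)
Lemma sum_mult_size (I : finType) (A : pred I) (a : I -> R) (m : I -> nat) (h : {poly R}) :
  h != 0 -> {in A &, injective a} ->
  (forall q, q \in A -> forall e, (e < m q)%N -> (h \Po ('X + (a q)%:P))`_e = 0) ->
  (\sum_(q in A) m q < size h)%N.
Proof.
move=> h0 inja hm.
have dvd q : q \in A -> ('X - (a q)%:P) ^+ m q %| h.
  move=> qA; rewrite -[h](comp_polyXaddC_K _ (a q)).
  rewrite -[X in _ %| X \Po _](poly_take_drop (m q)).
  have -> : take_poly (m q) (h \Po ('X + (a q)%:P)) = 0.
    by apply/polyP => e; rewrite coef_take_poly coef0; case: ifP => // /hm ->.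
  by rewrite add0r rmorphM rmorphXn /= comp_polyX dvdp_mull.
have : uniq (enum A) := enum_uniq A.
have : {subset enum A <= A} by move=> q; rewrite mem_enum.
rewrite -big_enum; move: (enum A) => s sA us.
suff [] : \prod_(q <- s) ('X - (a q)%:P) ^+ m q %| h /\
    size (\prod_(q <- s) ('X - (a q)%:P) ^+ m q) = (\sum_(q <- s) m q).+1.
  by case=> d <-; exact: dvdp_leq.
elim: s sA us => [|q s IH] sA /=; first by rewrite !big_nil dvd1p size_poly1.
move=> /andP[qs us]; have [|//|IHd IHs] := IH.
  by move=> r rs; apply: sA; rewrite inE rs orbT.
rewrite !big_cons; split.
  rewrite Gauss_dvdp ?dvd ?sA ?mem_head// coprimep_expl//.
  rewrite big_seq; elim/big_ind: _ => [|u v|r rs]; first exact: coprimep1.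
    by rewrite coprimepMr => -> ->.
  rewrite coprimep_expr// coprimep_XsubC2// subr_eq0; apply/eqP => /inja rq.
  by rewrite -rq ?rs ?sA ?mem_head// ?inE ?rs ?orbT// in qs.
rewrite size_mul ?size_exp_XsubC ?IHs ?addSn ?addnS//.
  by rewrite expf_neq0 // polyXsubC_eq0.
by rewrite -size_poly_gt0 IHs.
Qed.

(* The coefficient of [y^j z^k] in the expansion at [p] is a polynomial along the line
   through [p] with direction [d1]. *)
Lemma sum_vanishing_orders p d1 d2 d3 i j k (I : finType) (A : pred I) (a : I -> R)
    (m : I -> nat) :
  (expansion p d1 d2 d3)`_i`_j`_k != 0 -> {in A &, injective a} ->
  (forall q, q \in A -> forall e, (e < m q)%N ->
     (expansion (p + a q *: d1) d1 d2 d3)`_e`_j`_k = 0) ->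
  (\sum_(q in A) m q < 3 * n)%N.
Proof.
move=> ne inja am; rewrite (leq_trans _ (size_expansion p d1 d2 d3))//.
rewrite (leq_trans _ (size_slice j k _))//; apply: sum_mult_size inja _.
  by apply: contra_neq ne => h0; rewrite -coef_slice h0 coef0.
by move=> q qA e em; rewrite -slice_translate coef_slice am.
Qed.

End Expansion.

(** * The vanishing lemma *)

(** Lines enter only through the joints they carry, so the argument runs over finite types. *)
Definition along (R : realFieldType) (J Lambda : finType) (pos : J -> 'rV[R]_3)
    (inc : J -> Lambda -> bool) p l d :=
  forall q, inc q l -> exists s : R, pos q = pos p + s *: d.

Definition frame (R : realFieldType) (J Lambda : finType) (pos : J -> 'rV[R]_3)
    (inc : J -> Lambda -> bool) p (T : Lambda * Lambda * Lambda) :=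
  exists d : 'rV[R]_3 * 'rV[R]_3 * 'rV[R]_3,
  [/\ spans d.1.1 d.1.2 d.2, along pos inc p T.1.1 d.1.1,
      along pos inc p T.1.2 d.1.2 & along pos inc p T.2 d.2].

(** There are [n ^ 3] free coefficients and one linear condition for each entry of each box. *)
Lemma vanishing_conditions (R : realFieldType) (J : finType) (pos : J -> 'rV[R]_3)
    (d1 d2 d3 : J -> 'rV[R]_3) (b1 b2 b3 : J -> nat) (n : nat) :
  (\sum_p b1 p * b2 p * b3 p < n ^ 3)%N ->
  exists2 g : nat -> nat -> nat -> R,
    exists i j k, [/\ (i < n)%N, (j < n)%N, (k < n)%N & g i j k != 0] &
    forall p i j k, (i < b1 p)%N -> (j < b2 p)%N -> (k < b3 p)%N ->
      (expansion n g (pos p) (d1 p) (d2 p) (d3 p))`_i`_j`_k = 0.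
Proof.
case: n => [//|n] lt.
pose C := {p : J & ('I_(b1 p) * 'I_(b2 p) * 'I_(b3 p))%type}.
pose T := ('I_n.+1 * 'I_n.+1 * 'I_n.+1)%type.
pose A (t : T) (c : C) : R := (monomial3
  (affine3 (pos (tag c)) (d1 (tag c)) (d2 (tag c)) (d3 (tag c))) t.1.1 t.1.2 t.2)
  `_(tagged c).1.1 `_(tagged c).1.2 `_(tagged c).2.
have [|g [t0 g0] gA] := @kernel_family R T C A.
  rewrite !card_prod !card_ord card_tagged sumnE big_map big_enum /=.
  rewrite -mulnA -[(_ * (_ * _))%N]/(n.+1 ^ 3)%N; apply: leq_trans lt.
  by rewrite ltnS leq_sum// => p _; rewrite !card_prod !card_ord.
exists (fun i j k => g (inord i, inord j, inord k)) => [|p i j k ib jb kb].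
  by exists t0.1.1, t0.1.2, t0.2; split; rewrite // !inord_val -!surjective_pairing.
pose c : C := Tagged (fun p => 'I_(b1 p) * 'I_(b2 p) * 'I_(b3 p))%type
  (Ordinal ib, Ordinal jb, Ordinal kb).
apply: etrans (gA c); rewrite /expansion /sum3 !pair_bigA /= !coef_sum; apply: eq_bigr => t _.
by rewrite !inord_val -!surjective_pairing !coefCM.
Qed.

(* A polynomial with the prescribed vanishing has some order of vanishing [v p] at [p];
   at a joint of [H] minimizing [v p - alpha p] one line carries too many zeros. *)
Lemma vanishing_lemma (R : realFieldType) (J Lambda : finType) (pos : J -> 'rV[R]_3)
    (inc : J -> Lambda -> bool) (tau : J -> Lambda * Lambda * Lambda)
    (alpha : J -> nat) (t : Lambda -> nat) (H : {set J}) (n : nat) :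
  injective pos -> (0 < #|H|)%N ->
  (forall p, p \in H -> frame pos inc p (tau p)) ->
  (forall p l, p \in H -> l \in [:: (tau p).1.1; (tau p).1.2; (tau p).2] ->
     3 * n <= \sum_(q in H | inc q l) (alpha q - t l))%N ->
  (n ^ 3 <= \sum_(p in H) (alpha p - t (tau p).1.1) * (alpha p - t (tau p).1.2) *
                         (alpha p - t (tau p).2))%N.
Proof.
move=> pos_inj /card_gt0P[p0 p0H] Hframe Hsum; rewrite leqNgt; apply/negP => lt.
have /choice[d hd] : forall p, exists d : 'rV[R]_3 * 'rV[R]_3 * 'rV[R]_3, p \in H ->
  [/\ spans d.1.1 d.1.2 d.2, along pos inc p (tau p).1.1 d.1.1,
      along pos inc p (tau p).1.2 d.1.2 & along pos inc p (tau p).2 d.2].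
  move=> p; have [/Hframe[d hd]|] := boolP (p \in H); first by exists d.
  by exists (0, 0, 0).
pose b (l : J -> Lambda) p := if p \in H then (alpha p - t (l p))%N else 0%N.
have [|g [i0 [j0 [k0 [i0n j0n k0n g0]]]] gz] := @vanishing_conditions R J pos
  (fun p => (d p).1.1) (fun p => (d p).1.2) (fun p => (d p).2)
  (b (fun p => (tau p).1.1)) (b (fun p => (tau p).1.2)) (b (fun p => (tau p).2)) n.
  by move: lt; rewrite [X in (X < _)%N]big_mkcond; congr (_ < _)%N;
    apply: eq_bigr => p _; rewrite /b; case: ifP.
have /choice[v hv] : forall p, exists m, vanishes n g (pos p) m /\
  forall d1 d2 d3, spans d1 d2 d3 ->
  exists i j k, (i + j + k)%N = m /\ (expansion n g (pos p) d1 d2 d3)`_i`_j`_k != 0.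
  by move=> p; have [m] := exact_order (pos p) i0n j0n k0n g0; exists m.
(* Adding [S], a bound for every [alpha p], lets [v p - alpha p] be minimized without truncation. *)
pose S := (\sum_p alpha p)%N.
have leS p : (alpha p <= S)%N by rewrite /S (bigD1 p) //= leq_addr.
case: (arg_minnP (fun p => v p + (S - alpha p))%N p0H) => p pH pmin.
have {}pmin q : q \in H -> (v p + alpha q <= v q + alpha p)%N.
  by move=> /pmin; have := leS p; have := leS q; lia.
have line_case d1 d2 d3 l i j k :
    along pos inc p l d1 -> l \in [:: (tau p).1.1; (tau p).1.2; (tau p).2] ->
    (expansion n g (pos p) d1 d2 d3)`_i`_j`_k != 0 -> (i + j + k)%N = v p ->
    (i < alpha p - t l)%N.
  (* Otherwise minimality at [p] makes the slice of exponents [j], [k] vanish to order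
     [alpha q - t l] at every [q] of [H] on [l], which is too many zeros. The frame of [p] may be
     used at [q] since [vanishes] involves no basis. *)
  move=> al lin ne ijk; rewrite ltnNge; apply/negP => ile.
  have /choice[s hs] : forall q, exists s, inc q l -> pos q = pos p + s *: d1.
    move=> q; have [/al[s qs]|] := boolP (inc q l); first by exists s.
    by exists 0.
  have := Hsum p l pH lin; rewrite leqNgt => /negP; apply.
  apply: (@sum_vanishing_orders _ n g (pos p) d1 d2 d3 i j k J
    [pred q | (q \in H) && inc q l] s) => //.
    move=> q r; rewrite !inE => /andP[_ /hs qE] /andP[_ /hs rE] sqr.
    by apply: pos_inj; rewrite qE rE sqr.
  move=> q; rewrite inE => /andP[qH /hs <-] e elt.
  apply: (@vanishes_coef _ n g _ (v q)); first by have [] := hv q.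
  by have := pmin q qH; lia.
have [sp a1 a2 a3] := hd p pH.
(* A nonzero coefficient of total degree [v p] has its three exponents inside the box at [p], where
   all coefficients were made zero. *)
have [_ /(_ _ _ _ sp)[i [j [k [ijk ne]]]]] := hv p.
case/eqP: (ne); apply: gz; rewrite /b (pH : p \in H).
- by apply: line_case a1 _ ne ijk; rewrite !inE eqxx.
- apply: (line_case _ (d p).1.1 (d p).2 _ _ i k a2); rewrite ?inE ?eqxx ?orbT//; last first.
    by rewrite -ijk; lia.
  rewrite (@eval3_swap12 _ _ (expansion n g (pos p) (d p).1.1 (d p).1.2 (d p).2))//.
  by move=> x y z; rewrite !eval3_expansion [x *: _ + _]addrC.
- apply: (line_case _ (d p).1.2 (d p).1.1 _ _ j i a3); rewrite ?inE ?eqxx ?orbT//; last first.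
    by rewrite -ijk; lia.
  rewrite (@eval3_swap13 _ _ (expansion n g (pos p) (d p).1.1 (d p).1.2 (d p).2))//.
  move=> x y z; rewrite !eval3_expansion; congr (peval _ _ (_ + _)).
  by rewrite [LHS]addrC [x *: _ + _]addrC addrA.
Qed.

(** * Balancing *)

Section Levels.
Variables (J Lambda : finType) (inc : J -> Lambda -> bool) (K : nat).
Implicit Types (alpha : J -> nat) (p q : J) (l : Lambda).
Local Open Scope nat_scope.

Definition filled alpha l t := K <= \sum_(q | inc q l) (alpha q - t).

(** Beyond the sum of [alpha] all truncated differences are 0, so for [0 < K] the finite range loses
    nothing. The value is 0 if no [t] is filled. *)
Definition level alpha l :=
  \max_(t < (\sum_q alpha q).+1 | filled alpha l t) t.

Lemma filledS alpha alpha' l t t' : (forall q, alpha q <= alpha' q) -> t' <= t ->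
  filled alpha l t -> filled alpha' l t'.
Proof.
move=> aa tt /leq_trans; apply; apply: leq_sum => q _.
by have := aa q; lia.
Qed.

Lemma filled_level alpha l t : 0 < K -> filled alpha l 0 ->
  filled alpha l t = (t <= level alpha l).
Proof.
move=> K0 f0; apply/idP/idP => [ft|].
  have tS : t < (\sum_q alpha q).+1.
    rewrite ltnS leqNgt; apply/negP => St.
    have : \sum_(q | inc q l) (alpha q - t) = 0.
      apply: big1 => q _; apply/eqP; rewrite subn_eq0 (leq_trans _ (ltnW St))//.
      by rewrite (bigD1 q) //= leq_addr.
    by move: ft; rewrite /filled => + E; rewrite E leqn0 => /eqP K00; rewrite K00 in K0.
  exact: (bigop.leq_bigmax_cond (Ordinal tS)).
rewrite /level.
have [|i fi ->] := @bigop.eq_bigmax_cond _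
  [pred i : 'I_(\sum_q alpha q).+1 | filled alpha l i] (fun i => nat_of_ord i).
  by apply/card_gt0P; exists ord0.
by move=> ti; apply: filledS fi.
Qed.

Definition excess alpha p l := alpha p - level alpha l.

Definition excess3 alpha p (T : Lambda * Lambda * Lambda) :=
  excess alpha p T.1.1 * excess alpha p T.1.2 * excess alpha p T.2.

Lemma filled0 alpha p l : K <= alpha p -> inc p l -> filled alpha l 0.
Proof.
by move=> Kp pl; rewrite /filled (bigD1 p) //= subn0 (leq_trans Kp)// leq_addr.
Qed.

(** The next level is not filled, and one unit of level costs at most 1 per joint. *)
Lemma sum_excess alpha l : 0 < K -> filled alpha l 0 ->
  \sum_(q | inc q l) excess alpha q l <= K + #|J|.
Proof.
move=> K0 f0; have : ~~ filled alpha l (level alpha l).+1.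
  by rewrite filled_level// ltnn.
rewrite /filled -ltnNge => /ltnW lt.
apply: leq_trans (_ : \sum_(q | inc q l) (alpha q - (level alpha l).+1 + 1) <= _).
  by apply: leq_sum => q _; rewrite /excess; lia.
rewrite big_split leq_add// sum1_card; exact: max_card.
Qed.

Lemma excess_le alpha p l : 0 < K -> K <= alpha p -> inc p l ->
  excess alpha p l <= K + #|J|.
Proof.
move=> K0 Kp pl; apply: leq_trans (sum_excess K0 (filled0 Kp pl)).
by rewrite (bigD1 p) //= leq_addr.
Qed.

Definition bump1 alpha p q := alpha q + (q == p).

Lemma level_bump1 alpha p l : 0 < K -> filled alpha l 0 ->
  level alpha l <= level (bump1 alpha p) l.
Proof.
move=> K0 f0; have bb q : alpha q <= bump1 alpha p q by exact: leq_addr.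
rewrite -filled_level//; last exact: filledS f0.
by apply: (filledS bb (leqnn _)); rewrite filled_level.
Qed.

(** Levels can only rise, so an excess can grow only through [alpha] itself. *)
Lemma excess_bump1 alpha p q l : 0 < K -> filled alpha l 0 ->
  excess (bump1 alpha p) q l <= excess alpha q l + (q == p).
Proof.
by move=> K0 /(level_bump1 p K0); rewrite /excess /bump1; lia.
Qed.

Variables (S : J -> {set Lambda * Lambda * Lambda}) (T0 : J -> Lambda * Lambda * Lambda).
Hypothesis T0S : forall p, T0 p \in S p.
Hypothesis incS : forall p T, T \in S p -> [&& inc p T.1.1, inc p T.1.2 & inc p T.2].

(** The vanishing inequality holds for any choice of triples; the smallest product is the one that,
    multiplied by [#|S p|], stays below the sum over all of [S p]. *)
Definition best_triple alpha p := [arg min_(T < T0 p in S p) excess3 alpha p T].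

Definition weight alpha p := excess3 alpha p (best_triple alpha p).

Lemma best_triple_in alpha p : best_triple alpha p \in S p.
Proof. by rewrite /best_triple; case: arg_minnP. Qed.

Lemma weight_min alpha p T : T \in S p -> weight alpha p <= excess3 alpha p T.
Proof. by rewrite /weight /best_triple; case: arg_minnP => // T' _; apply. Qed.

(** Three factors bounded by [Q = K + #|J|] each grow by at most 1, so the product grows by at most
    [3 * Q ^ 2 + 3 * Q + 1]. *)
Lemma weight_bump1 alpha p : 0 < K -> (forall q, K <= alpha q) ->
  weight (bump1 alpha p) p <= weight alpha p + 7 * (K + #|J|).+1 ^ 2.
Proof.
move=> K0 Ka; have TS := best_triple_in alpha p.
apply: leq_trans (weight_min _ TS) _; rewrite /weight.
case/and3P: (incS TS) => i1 i2 i3; move: (best_triple alpha p) i1 i2 i3 => T i1 i2 i3.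
have aux l : inc p l ->
    excess (bump1 alpha p) p l <= excess alpha p l + 1 /\ excess alpha p l <= K + #|J|.
  move=> pl; split; last exact: excess_le.
  by have := excess_bump1 p p K0 (filled0 (Ka p) pl); rewrite eqxx.
have [e1 f1] := aux _ i1; have [e2 f2] := aux _ i2; have [e3 f3] := aux _ i3.
rewrite /excess3; set Q := K + _ in f1 f2 f3 *.
apply: leq_trans (leq_mul (leq_mul e1 e2) e3) _.
move: (excess alpha p _) (excess alpha p _) (excess alpha p _) f1 f2 f3 => x y z f1 f2 f3.
have xy := leq_mul f1 f2; have yz := leq_mul f2 f3; have xz := leq_mul f1 f3.
nia.
Qed.

Lemma weight_bump1_neq alpha p q : 0 < K -> (forall q, K <= alpha q) -> q != p ->
  weight (bump1 alpha p) q <= weight alpha q.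
Proof.
move=> K0 Ka qp; have TS := best_triple_in alpha q.
apply: leq_trans (weight_min _ TS) _; rewrite /weight.
case/and3P: (incS TS) => i1 i2 i3.
have aux l : inc q l -> excess (bump1 alpha p) q l <= excess alpha q l.
  move=> ql; have := excess_bump1 p q K0 (filled0 (Ka q) ql).
  by rewrite (negbTE qp) addn0.
by rewrite /excess3 !leq_mul ?aux.
Qed.

(** The cube expands into a sum over all ordered triples of lines through [p], among them those of
    [S p]. *)
Lemma card_weight alpha p :
  #|S p| * weight alpha p <= (\sum_(l | inc p l) excess alpha p l) ^ 3.
Proof.
rewrite -sum_nat_const.
apply: leq_trans (_ : \sum_(T in S p) excess3 alpha p T <= _).
  by apply: leq_sum => T; exact: weight_min.
have -> : (\sum_(l | inc p l) excess alpha p l) ^ 3 =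
    \sum_(T | inc p T.1.1 && inc p T.1.2 && inc p T.2) excess3 alpha p T.
  by rewrite !expnS expn0 muln1 mulnA big_distrlr pair_big big_distrlr pair_big.
rewrite big_mkcond [leqRHS]big_mkcond leq_sum// => T _.
by case: ifP => // /incS/and3P[-> -> ->].
Qed.

Lemma sum_sum_excess alpha : 0 < K -> (forall q, K <= alpha q) ->
  \sum_p \sum_(l | inc p l) excess alpha p l <= #|Lambda| * (K + #|J|).
Proof.
move=> K0 Ka; rewrite (exchange_big_dep xpredT) //= -sum_nat_const leq_sum// => l _.
have [p pl|no] := pickP (inc ^~ l); last by rewrite big_pred0.
exact: sum_excess (filled0 (Ka p) pl).
Qed.

(** * Termination of the balancing process *)

Variables (R : realFieldType) (m : nat) (target : J -> R).
Hypothesis target_ge0 : forall p, (0 <= target p)%R.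
Hypothesis K_gt0 : 0 < K.
Hypothesis vanishing : forall (tau : J -> Lambda * Lambda * Lambda) alpha
    (t : Lambda -> nat) (H : {set J}),
  0 < #|H| -> (forall p, p \in H -> tau p \in S p) ->
  (forall p l, p \in H -> l \in [:: (tau p).1.1; (tau p).1.2; (tau p).2] ->
     K <= \sum_(q in H | inc q l) (alpha q - t l)) ->
  m <= \sum_(p in H) (alpha p - t (tau p).1.1) * (alpha p - t (tau p).1.2) *
                     (alpha p - t (tau p).2).

Local Notation slack := (7 * (K + #|J|).+1 ^ 2).
Hypothesis target_lt : (\sum_p (target p + slack%:R) < m%:R)%R.

(** Invariant of raising, from the constant [K], joints whose weight is below target: a raised joint
    overshoots by at most one step's growth. *)
Definition admissible alpha := forall p, K <= alpha p /\
  (K < alpha p -> ((weight alpha p)%:R <= target p + slack%:R)%R).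

Lemma admissible_bump1 alpha p : admissible alpha ->
  ((weight alpha p)%:R < target p)%R -> admissible (bump1 alpha p).
Proof.
move=> adm wp; have Ka q : K <= alpha q by case: (adm q).
move=> q; split; first by rewrite (leq_trans (Ka q))// leq_addr.
have [->{q}|qp] := eqVneq q p => Kq.
  have := weight_bump1 p K_gt0 Ka; rewrite -(ler_nat R) natrD.
  by move=> /le_trans; apply; rewrite lerD2r ltW.
rewrite /bump1 (negbTE qp) addn0 in Kq; have [_ /(_ Kq)] := adm q.
by apply: le_trans; rewrite ler_nat weight_bump1_neq.
Qed.

(* If no value of [alpha] lies in a window of length [K], the joints above the window
   satisfy the vanishing inequality on their own, which exceeds the total target. *)
Lemma admissible_gap alpha s : admissible alpha -> (exists p, s + K < alpha p) ->
  exists p, s < alpha p <= s + K.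
Proof.
move=> adm [p0 p0s]; apply: contrapT => no.
have low q : alpha q <= s + K -> alpha q <= s.
  by move=> qsK; rewrite leqNgt; apply/negP => sq; apply: no; exists q; rewrite sq.
pose H := [set p | s + K < alpha p].
have : m <= \sum_(p in H) weight alpha p.
  apply: (@vanishing (best_triple alpha)).
  - by apply/card_gt0P; exists p0; rewrite inE.
  - by move=> p _; exact: best_triple_in.
  move=> p l; rewrite inE => sp lT.
  have pl : inc p l.
    have /and3P[i1 i2 i3] := incS (best_triple_in alpha p).
    by move: lT; rewrite !inE => /or3P[] /eqP->.
  have f0 : filled alpha l 0 by apply: filled0 pl; lia.
  (* The joint [p] alone fills [s] on [l], so joints with [alpha q <= s] have no excess there and
     the sum may be restricted to [H]. *)
  have sl : s <= level alpha l.
    by rewrite -filled_level// /filled (bigD1 p)//=; lia.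
  have : filled alpha l (level alpha l) by rewrite filled_level.
  rewrite /filled (bigID (mem H)) /= [X in _ + X]big1 ?addn0 => [|q].
    by under eq_bigl do rewrite andbC.
  by rewrite inE -leqNgt => /andP[_ /low]; lia.
apply/negP; rewrite -ltnNge -(ltr_nat R); apply: le_lt_trans target_lt.
rewrite natr_sum big_mkcond ler_sum// => p _; case: ifP => [|_].
  by rewrite inE => sp; case: (adm p) => _; apply; lia.
by rewrite addr_ge0// ler0n.
Qed.

(** Until all joints are covered, each further window of length [K] contains a new one, so [#|J|]
    windows suffice. *)
Lemma admissible_bounded alpha : admissible alpha -> forall p, alpha p <= #|J| * K.
Proof.
move=> adm.
suff cnt j : j <= #|[set p | alpha p <= j * K]| \/ forall p, alpha p <= j * K.
  have [full|//] := cnt #|J|; move=> p.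
  have /eqP allE : [set p | alpha p <= #|J| * K] == [set: J].
    by rewrite eqEcard finset.subsetT cardsT.
  by have := finset.in_setT p; rewrite -allE inE.
elim: j => [|j [IH|IH]]; first by left.
- have [/existsP ex|/existsPn all] := boolP [exists p, j * K + K < alpha p].
    have [p /andP[lo hi]] := admissible_gap adm ex.
    left; apply: leq_ltn_trans IH _; apply: proper_card; apply/properP; split.
      by apply/fintype.subsetP => q; rewrite !inE mulSn => /leq_trans; apply; exact: leq_addl.
    by exists p; rewrite !inE ?mulSn -?ltnNge// addnC.
  by right => p; rewrite mulSn addnC leqNgt.
- by right => p; rewrite mulSn (leq_trans (IH p))// leq_addl.
Qed.

(** Otherwise some joint could always be raised, and the sum of an admissible [alpha] would grow
    without bound. *)
Lemma balanced_exists : exists alpha, (forall p, K <= alpha p) /\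
  forall p, (target p <= (weight alpha p)%:R)%R.
Proof.
apply: contrapT => no.
have grow N : exists2 alpha, admissible alpha & N <= \sum_p alpha p.
  elim: N => [|N [alpha adm Na]].
    by exists (fun=> K) => // p; split; rewrite ?ltnn.
  have [p wp] : exists p, ((weight alpha p)%:R < target p)%R.
    apply: contrapT => all; apply: no; exists alpha; split=> p.
      by case: (adm p).
    by rewrite leNgt; apply/negP => wp; apply: all; exists p.
  exists (bump1 alpha p); first exact: admissible_bump1.
  rewrite big_split /=; apply: leq_ltn_trans Na _.
  by rewrite -addn1 leq_add2l (bigD1 p)//= eqxx.
have [alpha /admissible_bounded bd] := grow (#|J| * (#|J| * K)).+1.
by rewrite ltnNge -sum_nat_const leq_sum.
Qed.

End Levels.

(** * The estimate for abstract incidences *)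

Lemma sum_sqrt_frames (R : realType) (J Lambda : finType) (pos : J -> 'rV[R]_3)
    (inc : J -> Lambda -> bool) (S : J -> {set Lambda * Lambda * Lambda}) :
  injective pos -> (forall p, (0 < #|S p|)%N) ->
  (forall p T, T \in S p -> frame pos inc p T /\
     [&& inc p T.1.1, inc p T.1.2 & inc p T.2]) ->
  (\sum_p Num.sqrt (#|S p|%:R : R)) ^+ 2 <= 128 * #|Lambda|%:R ^+ 3.
Proof.
move=> pos_inj S0 frameS.
pose s p : R := Num.sqrt #|S p|%:R; pose D := \sum_p s p; rewrite -/D.
have s_ge1 p : 1 <= s p by rewrite -[leLHS]sqrtr1 ler_sqrt ?ler1n// ltr0n.
have [J0|] := posnP #|J|.
  have -> : D = 0 by apply: big_pred0 => p; have := fintype0 p J0.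
  by rewrite expr0n /= mulr_ge0// exprn_ge0.
(* The factor 300 makes the total slack [N * 7 * (K + N + 1) ^ 2] less than half of [n ^ 3], and
   gives [K + N <= 4 * n]. *)
set N := #|J| => N0; pose n := (300 * N)%N; pose K := (3 * n)%N.
have D_gt0 : 0 < D.
  apply: lt_le_trans (_ : \sum_(p : J) 1 <= D); last exact: ler_sum.
  by rewrite sumr_const ltr0n.
have /choice[T0 T0S] : forall p, exists T, T \in S p.
  by move=> p; exact/card_gt0P/S0.
have incS p T TS := proj2 (frameS p T TS).
(* The targets share out half of [n ^ 3] in proportion to [s p]; the other half absorbs the
   slack. *)
pose target p : R := s p * n%:R ^+ 3 / (2 * D).
have target_ge0 p : 0 <= target p.
  by rewrite mulr_ge0 ?invr_ge0 ?mulr_ge0 ?exprn_ge0 ?sqrtr_ge0// ltW.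
have van tau alpha t (H : {set J}) : (0 < #|H|)%N -> (forall p, p \in H -> tau p \in S p) ->
    (forall p l, p \in H -> l \in [:: (tau p).1.1; (tau p).1.2; (tau p).2] ->
      K <= \sum_(q in H | inc q l) (alpha q - t l))%N ->
    (n ^ 3 <= \sum_(p in H) (alpha p - t (tau p).1.1) * (alpha p - t (tau p).1.2) *
                     (alpha p - t (tau p).2))%N.
  move=> H0 tauS; apply: vanishing_lemma pos_inj H0 _.
  by move=> p /tauS/frameS[].
have K_gt0 : (0 < K)%N by rewrite /K /n; lia.
have [|alpha [Ka wa]] := @balanced_exists J Lambda inc K S T0 T0S incS R (n ^ 3)%N
    target target_ge0 K_gt0 van.
  rewrite big_split /= -!mulr_suml -/D sumr_const -/N.
  have -> : D * n%:R ^+ 3 / (2 * D) = n%:R ^+ 3 / 2 :> R by field; rewrite gt_eqF.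
  rewrite natrX -ltrBrDl -[ltRHS]/(n%:R ^+ 3 - n%:R ^+ 3 / 2).
  have -> : n%:R ^+ 3 - n%:R ^+ 3 / 2 = (n ^ 3)%:R / 2 :> R by rewrite natrX; field.
  rewrite ltr_pdivlMr// -mulrnA -natrM ltr_nat.
  by rewrite /K /n; nia.
(* As [#|S p|] is the square of [s p], [#|S p|] times the target is the cube of
   [s p * n * kappa]. *)
pose kappa : R := (2 * D)^-1 `^ 3^-1.
have kappa3 : kappa ^+ 3 = (2 * D)^-1.
  rewrite -powR_mulrn ?powR_ge0// -powRrM mulVf ?pnatr_eq0// powRr1//.
  by rewrite invr_ge0 mulr_ge0// ltW.
have kappa_ge0 : 0 <= kappa by exact: powR_ge0.
pose E p : nat := (\sum_(l | inc p l) excess inc K alpha p l)%N.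
have lowE p : s p * n%:R * kappa <= (E p)%:R.
  have sp0 : 0 <= s p by exact: sqrtr_ge0.
  rewrite -(ler_pXn2r (n := 3))// ?nnegrE ?mulr_ge0//.
  have := card_weight K T0S incS alpha p; rewrite -/(E p) => cw.
  apply: le_trans (_ : (#|S p| * weight inc K S T0 alpha p)%:R <= _); last first.
    by rewrite -natrX ler_nat cw.
  have := wa p; rewrite natrM => /(ler_wpM2l (ler0n R #|S p|)); apply: le_trans.
  by rewrite -[#|S p|%:R]sqr_sqrtr// -/(s p) /target !exprMn kappa3; lra.
have : D * n%:R * kappa <= 4 * #|Lambda|%:R * n%:R.
  rewrite /D -mulrA mulr_suml; apply: le_trans (_ : \sum_p (E p)%:R <= _).
    by apply: ler_sum => p _; rewrite mulrA.
  have := sum_sum_excess inc K_gt0 Ka; rewrite -/N -(ler_nat R) -natr_sum => /le_trans; apply.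
  by rewrite -!natrM ler_nat /K /n; nia.
have n0 : 0 < n%:R :> R by rewrite ltr0n /n; lia.
have Dk_ge0 : 0 <= D * kappa by rewrite mulr_ge0// ltW.
have L_ge0 : 0 <= 4 * #|Lambda|%:R :> R by rewrite mulr_ge0.
(* Cancelling [n] and cubing gives [D ^+ 2 / 2] at most 64 times the cube of [#|Lambda|], whence
   128. *)
rewrite mulrAC ler_pM2r// -(ler_pXn2r (n := 3)) ?nnegrE//.
rewrite !exprMn kappa3 => le3.
have -> : D ^+ 2 = 2 * (D ^+ 3 * (2 * D)^-1) by field; rewrite gt_eqF.
by move: le3; lra.
Qed.

(** * Joints of a family of lines *)

Local Open Scope classical_set_scope.

Lemma spans_fullv (R : realFieldType) (d1 d2 d3 : 'rV[R]_3) :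
  <<[:: d1; d2; d3]>>%VS = fullv -> spans d1 d2 d3.
Proof.
move=> sp u; have : u \in <<[:: d1; d2; d3]>>%VS by rewrite sp memvf.
rewrite !span_cons span_nil addv0.
move=> /memv_addP[u1 /vlineP[x ->] [v /memv_addP[u2 /vlineP[y ->] [u3 /vlineP[z ->] ->]] ->]].
by exists x, y, z; rewrite addrA.
Qed.

Section Incidence.
Variables (R : realType) (LL : {fset (set 'rV[R]_3)}).

Definition joint_type : finType := fset_set (joints LL).
Definition line_type : finType := LL.

Definition incident (p : joint_type) (l : line_type) : bool := `[< val l (val p) >].

(** These triples are ordered, unlike those counted by [multiplicity]; overcounting is harmless for
    an upper bound. *)
Definition spanning_triples (p : joint_type) : {set line_type * line_type * line_type} :=
  [set T | [&& incident p T.1.1, incident p T.1.2, incident p T.2 &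
    `[< directions_span (val T.1.1) (val T.1.2) (val T.2) >]]].

Lemma spanning_triples_gt0 p : (0 < #|spanning_triples p|)%N.
Proof.
have := valP p; rewrite in_fset_set; last exact: finite_joints.
rewrite inE => -[l1 [l2 [l3 [[h1 h2 h3] x1 x2 x3 sp]]]].
apply/card_gt0P; exists ([` h1]%fset, [` h2]%fset, [` h3]%fset).
by rewrite inE; apply/and4P; split; apply/asboolP.
Qed.

Lemma spanning_triples_frame p T : T \in spanning_triples p ->
  frame (fun q : joint_type => val q) incident p T.
Proof.
rewrite inE => /and4P[/asboolP i1 /asboolP i2 /asboolP i3 /asboolP].
move=> [d1 [d2 [d3 [D1 D2 D3 sp]]]]; exists (d1, d2, d3).
have al l d : is_direction (val l) d -> val l (val p) ->
    along (fun q : joint_type => val q) incident p l d.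
  move=> Dl lp q /asboolP lq; have [s qp] := line_direction_through Dl lp lq.
  by exists s; rewrite -qp addrC subrK.
by split=> /=; [exact: spans_fullv|exact: al|exact: al|exact: al].
Qed.

(** Forgetting the order maps the ordered spanning triples onto the unordered ones. *)
Lemma multiplicity_le p : (multiplicity LL (val p) <= #|spanning_triples p|)%N.
Proof.
pose f (T : line_type * line_type * line_type) :=
  [fset val T.1.1; val T.1.2; val T.2]%fset.
apply: leq_trans (_ : #|` [fset f T | T in spanning_triples p]%fset| <= _)%N; last first.
  by apply: leq_trans (leq_imfset_card _ _ _) _; rewrite cardE.
apply: fsubset_leq_card; apply/fsubsetP => T; rewrite !inE /= => /andP[].
rewrite fpowersetE => /fsubsetP TL /asboolP[l1 [l2 [l3 [TE x1 x2 x3 sp]]]].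
have h1 : l1 \in LL by apply: TL; rewrite TE !inE eqxx.
have h2 : l2 \in LL by apply: TL; rewrite TE !inE eqxx orbT.
have h3 : l3 \in LL by apply: TL; rewrite TE !inE eqxx orbT.
apply/imfsetP; exists ([` h1]%fset, [` h2]%fset, [` h3]%fset) => //=.
by rewrite inE; apply/and4P; split; apply/asboolP.
Qed.

End Incidence.

Theorem theorem1p1p1 (R : realType) :
  exists c : R, forall LL : {fset (set 'rV[R]_3)},
    (forall l : set 'rV[R]_3, l \in LL -> is_line l) ->
    \sum_(x \in joints LL) ((multiplicity LL x)%:R : R) `^ (1 / 2) <=
      c * (#|` LL|%fset)%:R `^ (3 / 2).
Proof.
(* The square of 12 is 144, which exceeds 128. *)
exists 12 => LL _; rewrite fsbig_finite; last exact: finite_joints.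
rewrite big_seq_fsetE /=.
apply: le_trans (_ : \sum_p Num.sqrt (#|spanning_triples (LL := LL) p|%:R : R) <= _).
  apply: ler_sum => p _; rewrite div1r powR12_sqrt// ler_sqrt// ler_nat.
  exact: multiplicity_le.
set D := \sum_p _; have D_ge0 : 0 <= D by apply: sumr_ge0 => p _; exact: sqrtr_ge0.
have D2 : D ^+ 2 <= 128 * #|` LL|%fset%:R ^+ 3.
  rewrite cardfE; apply: sum_sqrt_frames val_inj (@spanning_triples_gt0 R LL) _.
  move=> p T TS; split; first exact: spanning_triples_frame TS.
  by move: TS; rewrite inE => /and4P[-> -> ->].
have L3 : ((#|` LL|%fset%:R : R) `^ (3 / 2)) ^+ 2 = #|` LL|%fset%:R ^+ 3.
  rewrite -powR_mulrn ?powR_ge0// -powRrM divfK ?pnatr_eq0//.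
  by rewrite powR_mulrn.
rewrite -(ler_pXn2r (n := 2)) ?nnegrE ?mulr_ge0 ?powR_ge0//.
apply: le_trans D2 _; rewrite exprMn L3 ler_wpM2r ?exprn_ge0//.
by rewrite -natrX ler_nat.
Qed.
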